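(* Let $\xi$ be a Laurent Puiseux series in $x=(x_1,\dots,x_n)$ whose support is included in a translation of a strongly convex cone containing $\mathbb{R}_{\geq 0}^n$ and with coefficients in a characteristic zero field $\mathbb{K}$. Assume that $\xi$ is algebraic over $\mathbb{K}(\!(x)\!)$. Then there is $\gamma\in\mathbb{Z}^n$ such that $$\operatorname{Supp}(\xi)\subset\gamma+\tau(\xi)^\vee.$$ Moreover $\tau(\xi)^\vee$ is the smallest (not necessarily polyhedral) cone having this property; that is, for every (not necessarily polyhedral) cone $\sigma$ such that $\operatorname{Supp}(\xi)\subset\gamma'+\sigma$ for some $\gamma'\in\mathbb{Z}^n$, one has $\tau(\xi)^\vee\subset\sigma$.
   Context: $\mathbb{K}[[x]]$ is the ring of formal power series in $n$ indeterminates and $\mathbb{K}(\!(x)\!)$ its fraction field. A series is a formal sum $\xi=\sum_{\alpha\in\mathbb{Q}^n}\xi_\alpha x^\alpha$ with $\xi_\alpha\in\mathbb{K}$; its support is $\operatorname{Supp}(\xi)=\{\alpha\in\mathbb{Q}^n\mid\xi_\alpha\neq 0\}$. It is a Laurent Puiseux series if $\operatorname{Supp}(\xi)\subset\frac1k\mathbb{Z}^n$ for some integer $k\geq 1$. A cone is a subset of $\mathbb{R}^n$ stable under multiplication by nonnegative reals; cones are polyhedral (generated by finitely many vectors with nonnegative real coefficients) unless stated otherwise; a cone is strongly convex if it contains no nontrivial linear subspace. When $\operatorname{Supp}(\xi)$ lies in a translation of a strongly convex cone containing $\mathbb{R}_{\geq 0}^n$, $P(x,\xi)$ is well defined for every $P\in\mathbb{K}[[x]][T]$,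 and $\xi$ is algebraic over $\mathbb{K}(\!(x)\!)$ if $P(x,\xi)=0$ for some nonzero such $P$. Define $$\tau(\xi)=\{\omega\in\mathbb{R}_{\geq 0}^n\mid \exists k\in\mathbb{R},\ \operatorname{Supp}(\xi)\cap\{u\in\mathbb{R}^n\mid u\cdot\omega\leq k\}=\emptyset\}.$$ The dual of a cone $\sigma$ is $\sigma^\vee=\{v\in\mathbb{R}^n\mid v\cdot u\geq 0\ \text{for all } u\in\sigma\}$.
   Formalization: In the minimality clause σ ranges over closed convex (not necessarily polyhedral) cones containing the nonnegative orthant; for arbitrary cones the clause is false, e.g. ξ = 1 with σ = {0}. *)

(* Defs.v *)
From HB Require Import structures.
From mathcomp Require Import all_boot all_order all_algebra.
From mathcomp Require Import all_classical all_reals topology normedtype convex interval_inference.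

Set Implicit Arguments.
Unset Strict Implicit.
Unset Printing Implicit Defensive.

Import Order.TTheory GRing.Theory Num.Theory.
Import numFieldNormedType.Exports.

Local Open Scope classical_set_scope.
Local Open Scope ring_scope.

Section FormalSeries.
Variables (K : fieldType) (n : nat).

(* [xi a] is the coefficient of x^a; there is no restriction on the support. *)
Definition fseries := 'rV[rat]_n -> K.

Definition Supp (xi : fseries) : set 'rV[rat]_n := [set a | xi a != 0].

Definition laurent_puiseux (xi : fseries) : Prop :=
  exists2 k : nat, (0 < k)%N &
    forall a, Supp xi a ->
      exists z : 'rV[int]_n, a = k%:R^-1 *: map_mx intr z.

(* K[[x]] is identified with the series supported in N^n. *)
Definition power_series (f : fseries) : Prop :=
  forall a, Supp f a -> exists m : 'rV[nat]_n, a = map_mx (fun i => i%:R) m.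

Definition fseries_one : fseries := fun a => (a == 0)%:R.

(* Cauchy product. The sum is over all of Q^n and is 0 by convention when it  *)
(* has infinitely many nonzero terms; this does not occur for Laurent         *)
(* Puiseux series supported in translations of one strongly convex cone.      *)
Definition fseries_mul (f g : fseries) : fseries :=
  fun a => \sum_(b \in [set: 'rV[rat]_n]) f b * g (a - b).

Definition fseries_exp (xi : fseries) (i : nat) : fseries :=
  iter i (fseries_mul xi) fseries_one.

(* The polynomial sum_(i < d) P_i T^i evaluated at T = xi. *)
Definition fseries_horner (d : nat) (P : 'I_d -> fseries) (xi : fseries) : fseries :=
  fun a => \sum_(i < d) fseries_mul (P i) (fseries_exp xi i) a.

(* Algebraicity over the fraction field K((x)), with denominators cleared. *)
Definition algebraic_fseries (xi : fseries) : Prop :=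
  exists (d : nat) (P : 'I_d -> fseries),
    [/\ forall i, power_series (P i),
        exists i a, P i a != 0
      & forall a, fseries_horner P xi a = 0].

End FormalSeries.

Section Cones.
Variables (R : realType) (n : nat).
Implicit Types (sigma : set 'rV[R]_n) (u v w : 'rV[R]_n).

Definition dotv u v : R := \sum_i u ord0 i * v ord0 i.

Definition orthant : set 'rV[R]_n := [set u | forall i, 0 <= u ord0 i].

Definition cone sigma : Prop :=
  forall (c : R) u, 0 <= c -> sigma u -> sigma (c *: u).

Definition polyhedral_cone sigma : Prop :=
  exists (m : nat) (g : 'I_m -> 'rV[R]_n),
    sigma = [set u | exists2 c : 'I_m -> R,
                       (forall i, 0 <= c i) & u = \sum_i c i *: g i].

Definition strongly_convex sigma : Prop :=
  forall V : {vspace 'rV[R]_n},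
    (forall u, u \in V -> sigma u) -> V = 0%VS.

Definition translate v sigma : set 'rV[R]_n := [set v + u | u in sigma].

Definition dual_cone sigma : set 'rV[R]_n :=
  [set v | forall u, sigma u -> 0 <= dotv v u].

(* The cones among which tau(xi)^vee is the smallest one whose translates     *)
(* contain Supp(xi). None of the last three conditions can be dropped: take   *)
(* xi = 1 and sigma = {0} (orthant), or xi = sum_k (x1/x2)^k = x2/(x2 - x1)   *)
(* and sigma = orthant `|` R_{>=0} (1, -1) (convexity), respectively          *)
(* sigma = {0} `|` {u | u1 >= 0 and u1 + u2 > 0} (closedness).                *)
Definition admissible_cone sigma : Prop :=
  [/\ cone sigma, convex_set (sigma : set (convex_lmodType 'rV[R]_n)),
      closed sigma & orthant `<=` sigma].

End Cones.

Section Tau.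
Variables (R : realType) (K : fieldType) (n : nat).

Definition SuppR (xi : fseries K n) : set 'rV[R]_n :=
  [set map_mx ratr a | a in Supp xi].

Definition tau (xi : fseries K n) : set 'rV[R]_n :=
  [set w | orthant w /\
     exists k : R, SuppR xi `&` [set u | dotv u w <= k] = set0].

End Tau.
Arguments SuppR R {K n} xi.
Arguments tau R {K n} xi.

Lemma dual_tau_admissible (R : realType) (K : fieldType) (n : nat)
    (xi : fseries K n) : admissible_cone (dual_cone (tau R xi)).
Proof.
have dD (u v w : 'rV[R]_n) : dotv (u + v) w = dotv u w + dotv v w.
  by rewrite /dotv -big_split; apply: eq_bigr => i _; rewrite mxE mulrDl.
have dZ c (u w : 'rV[R]_n) : dotv (c *: u) w = c * dotv u w.
  by rewrite /dotv mulr_sumr; apply: eq_bigr => i _; rewrite mxE mulrA.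
split.
- by move=> c u c0 hu w tw; rewrite dZ mulr_ge0// hu.
- move=> u v t; rewrite !inE => hu hv w tw.
  rewrite dD !dZ addr_ge0 ?mulr_ge0 ?hu ?hv ?subr_ge0 //.
- rewrite /dual_cone.
  rewrite [X in closed X](_ : _ =
    \bigcap_(w in tau R xi) [set v | 0 <= dotv v w]) //.
  apply: closed_bigI => w _.
  have cw : continuous (fun v : 'rV[R]_n => dotv v w).
    apply: continuous_big => [|i _]; first exact: add_continuous.
    move=> v; apply: continuousM; [exact: coord_continuous | exact: cst_continuous].
  exact: (preimage_closed (fun v _ => cw v) (@closed_ge R 0)).
- by move=> u hu w [hw _]; apply: sumr_ge0 => i _; rewrite mulr_ge0.
Qed.

(* Main.v *)
(** Let P = sum_i P_i T^i annihilate xi, let D be the largest index with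
    P_D <> 0, and let beta be any exponent of P_D. Then gamma = - beta works.
    Take w in tau(xi) and w0 in the interior of the dual of the given strongly
    convex cone. For every e > 0 the supports of xi and P_D are finite below
    each level of w' = w + e w0, so xi and P_D have leading monomials a and p
    for a total group order refining w', and leading monomials multiply. If
    w'.a < - w'.p, the leading monomial of P_D xi^D has smaller w'-weight than
    all monomials of the P_i xi^i with i < D, contradicting P(xi) = 0. Hence
    w'.u >= w'.a >= - w'.p >= - w'.beta for u in the support of xi, and e -> 0
    gives w.u >= - w.beta.

    For minimality, an admissible cone sigma with a translate containing the
    support has its dual inside tau(xi), so tau(xi)^vee lies in the bidual of
    sigma, which is sigma. *)

Require Import Defs.
From HB Require Import structures.
From mathcomp Require Import all_boot all_order all_algebra.
From mathcomp Require Import all_classical all_reals topology normedtype convex.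
From mathcomp Require Import derive interval_inference ring lra zify.

Set Implicit Arguments.
Unset Strict Implicit.
Unset Printing Implicit Defensive.

Import Order.TTheory GRing.Theory Num.Theory.
Import numFieldNormedType.Exports.

Local Open Scope classical_set_scope.
Local Open Scope ring_scope.

(** * Bilinearity and positivity of the dot product *)

Section DotProduct.
Variables (R : realType) (n : nat).
Implicit Types u v w : 'rV[R]_n.

Lemma dotvC u v : dotv u v = dotv v u.
Proof. by apply: eq_bigr => i _; rewrite mulrC. Qed.

Lemma dotvDl u v w : dotv (u + v) w = dotv u w + dotv v w.
Proof.
by rewrite /dotv -big_split; apply: eq_bigr => i _; rewrite mxE mulrDl.
Qed.

Lemma dotvZl c u w : dotv (c *: u) w = c * dotv u w.
Proof.
by rewrite /dotv mulr_sumr; apply: eq_bigr => i _; rewrite mxE mulrA.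
Qed.

Lemma dotvDr u v w : dotv w (u + v) = dotv w u + dotv w v.
Proof. by rewrite dotvC dotvDl !(dotvC w). Qed.

Lemma dotvZr c u w : dotv w (c *: u) = c * dotv w u.
Proof. by rewrite dotvC dotvZl dotvC. Qed.

Lemma dotvNl u w : dotv (- u) w = - dotv u w.
Proof. by rewrite -scaleN1r dotvZl mulN1r. Qed.

Lemma dotvBl u v w : dotv (u - v) w = dotv u w - dotv v w.
Proof. by rewrite dotvDl dotvNl. Qed.

Lemma dotvBr u v w : dotv w (u - v) = dotv w u - dotv w v.
Proof. by rewrite dotvC dotvBl !(dotvC w). Qed.

Lemma dot0v w : dotv 0 w = 0.
Proof. by rewrite -(scale0r 0) dotvZl mul0r. Qed.

Lemma dotv_suml (m : nat) (g : 'I_m -> 'rV[R]_n) w :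
  dotv (\sum_i g i) w = \sum_i dotv (g i) w.
Proof.
by apply: (big_morph (fun u => dotv u w)) => [u v|]; rewrite ?dotvDl ?dot0v.
Qed.

Lemma dotvv_ge0 u : 0 <= dotv u u.
Proof. by apply: sumr_ge0 => i _; rewrite -expr2 sqr_ge0. Qed.

Lemma dotvv_eq0 u : (dotv u u == 0) = (u == 0).
Proof.
apply/eqP/eqP => [uu0|->]; last exact: dot0v.
apply/rowP => i; rewrite mxE; apply/eqP; rewrite -sqrf_eq0 expr2; apply/eqP.
by apply: (psumr_eq0P _ uu0) => // j _; rewrite -expr2 sqr_ge0.
Qed.

Lemma dotvv_gt0 u : (0 < dotv u u) = (u != 0).
Proof. by rewrite lt_def dotvv_ge0 andbT dotvv_eq0. Qed.

Lemma sqr_coord_le_dotvv u i : u ord0 i ^+ 2 <= dotv u u.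
Proof.
rewrite /dotv (bigD1 i)//= -expr2 lerDl.
by apply: sumr_ge0 => j _; rewrite -expr2 sqr_ge0.
Qed.

End DotProduct.

(** * Total group orders on exponents refining a weight *)

Section MonomialOrder.
Variables (R : realType) (n : nat).
Implicit Types (w : 'rV[R]_n) (a b : 'rV[rat]_n).

Definition weight w a : R := dotv (map_mx ratr a) w.

Lemma weight_is_additive w : additive (weight w).
Proof. by move=> a b; rewrite /weight map_mxB dotvBl. Qed.

HB.instance Definition _ w :=
  GRing.isZmodMorphism.Build 'rV[rat]_n R (weight w) (weight_is_additive w).

Definition lex_pos a : bool :=
  [exists i, (0 < a ord0 i) && [forall j : 'I_n, (j < i)%N ==> (a ord0 j == 0)]].

Lemma lex_posP a :
  reflect (exists2 i, 0 < a ord0 i & forall j : 'I_n, (j < i)%N -> a ord0 j = 0)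
          (lex_pos a).
Proof.
apply: (iffP existsP) => -[i].
  by case/andP=> ai /forallP aj; exists i => // j ji; apply/eqP/(implyP (aj j)).
move=> ai aj; exists i; rewrite ai; apply/forallP => j.
by apply/implyP => /aj ->.
Qed.

Lemma lex_posD a b : lex_pos a -> lex_pos b -> lex_pos (a + b).
Proof.
move=> /lex_posP[i ai aj] /lex_posP[k bk bj]; apply/lex_posP.
case: (ltngtP i k) => [ik|ki|/(@ord_inj n) ik].
- exists i => [|j ji]; first by rewrite mxE (bj i)// addr0.
  by rewrite mxE aj// bj ?addr0// (ltn_trans ji).
- exists k => [|j jk]; first by rewrite mxE (aj k)// add0r.
  by rewrite mxE bj// aj ?addr0// (ltn_trans jk).
- subst k; exists i => [|j ji]; first by rewrite mxE addr_gt0.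
  by rewrite mxE aj// bj// addr0.
Qed.

Lemma lex_pos0 : lex_pos 0 = false.
Proof. by apply/lex_posP => -[i]; rewrite mxE ltxx. Qed.

Lemma lex_pos_total a : a != 0 -> lex_pos a || lex_pos (- a).
Proof.
case/rV0Pn => i0 ai0.
have [i ai imin] := @arg_minnP _ i0 (fun i => a ord0 i != 0) (@nat_of_ord n) ai0.
have a0 (j : 'I_n) : (j < i)%N -> a ord0 j = 0.
  by apply: contraTeq => /imin; rewrite leqNgt.
case: (ltgtP (a ord0 i) 0) ai => // ai _; apply/orP; [right|left];
  apply/lex_posP; exists i => //.
- by rewrite mxE oppr_gt0.
- by move=> j /a0; rewrite mxE => ->; rewrite oppr0.
Qed.

(* Positive cone of a total group order on Q^n that refines the preorder given
   by the weight; lexicographic tie-breaking makes leading monomials unique. *)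
Definition mono_pos w a : bool :=
  (0 < weight w a) || (weight w a == 0) && lex_pos a.

Lemma mono_pos_ge0 w a : mono_pos w a -> 0 <= weight w a.
Proof. by case/orP=> [/ltW//|/andP[/eqP->]]. Qed.

Lemma mono_posD w a b : mono_pos w a -> mono_pos w b -> mono_pos w (a + b).
Proof.
rewrite /mono_pos raddfD /= => /orP[a0|/andP[/eqP a0 la]].
  by move=> /(@mono_pos_ge0 w) b0; rewrite ltr_wpDr.
case/orP=> [b0|/andP[/eqP b0 lb]]; first by rewrite a0 add0r b0.
by rewrite a0 b0 addr0 eqxx lex_posD// orbT.
Qed.

Lemma mono_pos0 w : mono_pos w 0 = false.
Proof. by rewrite /mono_pos raddf0 ltxx lex_pos0 andbF. Qed.

Lemma mono_pos_total w a : a != 0 -> mono_pos w a || mono_pos w (- a).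
Proof.
move=> a0; rewrite /mono_pos raddfN /= oppr_gt0 oppr_eq0.
by case: (ltgtP (weight w a) 0) => //= _; exact: lex_pos_total.
Qed.

Lemma mono_pos_asym w a : mono_pos w a -> mono_pos w (- a) = false.
Proof.
by move=> ha; apply/negP => /(mono_posD ha); rewrite subrr mono_pos0.
Qed.

Lemma mono_min_seq w (s : seq 'rV[rat]_n) : s != [::] ->
  exists2 a, a \in s & forall b, b \in s -> b != a -> mono_pos w (b - a).
Proof.
elim: s => // x s IHs _; have [->|/IHs[a sa amin]] := eqVneq s [::].
  by exists x => [|b]; rewrite ?mem_head// inE => ->.
have [xa|xa] := eqVneq x a.
  exists a => [|b]; rewrite !inE ?sa ?orbT// => /orP[/eqP->|/amin//].
  by rewrite xa eqxx.
move: (xa); rewrite -subr_eq0 => /(mono_pos_total w)/orP[pxa|].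
  by exists a => [|b]; rewrite inE ?sa ?orbT// => /orP[/eqP->|/amin].
rewrite opprB => pax; exists x => [|b]; rewrite ?mem_head// inE.
case/orP=> [->//|sb bx]; have [->//|ba] := eqVneq b a.
by rewrite -(subrKA a) mono_posD// amin.
Qed.

End MonomialOrder.

(** * Leading monomials and their multiplicativity *)

Section LeadingMonomial.
Variables (R : realType) (K : fieldType) (n : nat) (w : 'rV[R]_n).
Implicit Types (f g xi : fseries K n) (a b : 'rV[rat]_n).

Definition leading f a : Prop :=
  f a != 0 /\ forall b, f b != 0 -> b != a -> mono_pos w (b - a).

Definition level_finite f : Prop :=
  forall c : R, finite_set [set a | Supp f a /\ weight w a <= c].

Lemma leading_weight f a b : leading f a -> f b != 0 -> weight w a <= weight w b.
Proof.
move=> [_ amin] fb; have [->//|ba] := eqVneq b a.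
by rewrite -subr_ge0 -raddfB mono_pos_ge0// amin.
Qed.

(** Only finitely many exponents of [f] weigh at most as much as [a]. Their minimum is global, since
    every other exponent is strictly heavier. *)
Lemma leading_exists f a : level_finite f -> f a != 0 -> exists b, leading f b.
Proof.
move=> finf fa; have /finite_seqP[s sE] := finf (weight w a).
have inS b : (b \in s) <-> f b != 0 /\ weight w b <= weight w a.
  by have := congr1 (@^~ b) sE; rewrite /= => <-.
have as_ : a \in s by apply/inS.
have [|b /inS[fb ba] bmin] := @mono_min_seq _ _ w s.
  by apply: contraTneq as_ => ->.
exists b; split=> // c fc cb; have [ca|ca] := leP (weight w c) (weight w a).
  by apply: bmin => //; apply/inS.
by apply/orP; left; rewrite raddfB subr_gt0 (le_lt_trans ba).
Qed.

Lemma fseries_mul_neq0 f g a : fseries_mul f g a != 0 ->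
  exists b, f b != 0 /\ g (a - b) != 0.
Proof.
case/(fsbigN1 (f := fun a b => f b * g (a - b))) => b _.
by rewrite mulf_eq0 negb_or => /andP[]; exists b.
Qed.

(** At exponent [a + b] only the pair [(a, b)] contributes: another pair would put one factor below
    its leading exponent. The Cauchy sum there has a single nonzero term, so its convention for
    infinite sums does not interfere. *)
Lemma leading_mul f g a b :
  leading f a -> leading g b -> leading (fseries_mul f g) (a + b).
Proof.
move=> [fa amin] [gb bmin]; split.
  rewrite /fseries_mul -(fsbig_widen [set a])//.
    by rewrite fsbig_set1 addrAC subrr add0r mulf_neq0.
  move=> c /= [_ /eqP ca]; apply/eqP; apply: contraT.
  rewrite mulf_eq0 negb_or => /andP[fc].
  have -> : a + b - c = b - (c - a) by rewrite opprB addrCA addrA.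
  move=> /bmin.
  rewrite -subr_eq0 addrAC subrr add0r oppr_eq0 subr_eq0 => /(_ ca).
  by rewrite mono_pos_asym// amin.
move=> c /fseries_mul_neq0[d [fd gcd]] cab.
have -> : c - (a + b) = (d - a) + (c - d - b).
  by apply/rowP => i; rewrite !mxE; ring.
have [da|da] := eqVneq d a.
  rewrite da subrr add0r -da bmin//; apply: contra cab => /eqP <-.
  by rewrite -da addrC subrK.
have [cb|cb] := eqVneq (c - d) b; first by rewrite cb subrr addr0 amin.
by rewrite mono_posD ?amin ?bmin.
Qed.

Lemma leading_one : leading (@fseries_one K n) 0.
Proof.
rewrite /leading /fseries_one eqxx oner_eq0; split=> // b.
by case: (b == 0); rewrite ?eqxx.
Qed.

Lemma leading_exp xi a i : leading xi a -> leading (fseries_exp xi i) (a *+ i).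
Proof.
move=> xia; elim: i => [|i IHi]; first exact: leading_one.
by rewrite mulrS /=; exact: leading_mul.
Qed.

Lemma weight_power_series f a : orthant w -> power_series f -> f a != 0 ->
  0 <= weight w a.
Proof.
move=> w0 psf /psf[m ->]; apply: sumr_ge0 => i _.
by rewrite !mxE ratr_nat mulr_ge0 ?w0.
Qed.

(* If the leading monomial of xi had smaller weight than minus that of the top
   coefficient, the leading monomial of the top term could not be cancelled. *)
Lemma root_leading_weight d (P : 'I_d -> fseries K n) xi (D : 'I_d) a b :
  orthant w -> (forall i, power_series (P i)) ->
  (forall i : 'I_d, (D < i)%N -> forall c, P i c = 0) ->
  leading (P D) b -> leading xi a ->
  (forall c, fseries_horner P xi c = 0) ->
  - weight w b <= weight w a.
Proof.
move=> w0 psP Ptop Db xia root; rewrite leNgt; apply/negP => lt_a.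
have := root (b + a *+ D); rewrite /fseries_horner (bigD1 D)//= big1 => [|i iD].
  rewrite addr0; apply/eqP.
  by have [] := leading_mul Db (leading_exp D xia).
apply/eqP; apply: contraT => /fseries_mul_neq0[c [Pc xc]].
have ltiD : (i < D)%N.
  rewrite ltn_neqAle iD leqNgt; apply: contra_neqN Pc => Di.
  exact: Ptop.
have := leading_weight (leading_exp i xia) xc.
have c0 := weight_power_series w0 (psP i) Pc.
have b0 := weight_power_series w0 (psP D) Db.1.
rewrite raddfB raddfD !raddfMn /= -(subnK (ltnW ltiD)) mulrnDr.
(* Since [weight w a < - weight w b <= 0], further copies of [a] only lower the weight. Hence
   [weight w c <= weight w b + weight w a < 0], which is impossible for an exponent of a power
   series. *)
have : (weight w a) *+ (D - i) <= weight w a.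
  rewrite -(subnSK ltiD) mulrS gerDl mulrn_wle0//; lra.
lra.
Qed.

End LeadingMonomial.

(** * Nearest points, biduality and Gordan's theorem *)

Section Separation.
Variables (R : realType) (n : nat).
Implicit Types (u v w x : 'rV[R]_n) (sigma : set 'rV[R]_n).

Lemma dotv_continuous m (f g : 'rV[R]_m -> 'rV[R]_n) :
  continuous f -> continuous g -> continuous (fun z : 'rV[R]_m => dotv (f z) (g z)).
Proof.
move=> cf cg; apply: continuous_big => [|i _]; first exact: add_continuous.
move=> z; apply: continuousM.
  exact: (continuous_comp (cf z) (@coord_continuous _ _ _ ord0 i (f z))).
exact: (continuous_comp (cg z) (@coord_continuous _ _ _ ord0 i (g z))).
Qed.

Lemma closed_box_min m (S : set 'rV[R]_m) (B : R) (f : 'rV[R]_m -> R) :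
    S !=set0 -> closed S -> (forall y, S y -> forall i, `|y ord0 i| <= B) ->
    continuous f ->
  exists2 p, S p & forall y, S y -> f p <= f y.
Proof.
move=> S0 clS SB cf.
have cS : compact S.
  have cbox : compact [set v : 'rV[R]_m | forall i, v ord0 i \in `[- B, B]].
    apply: (@rV_compact _ _ (fun=> `[- B, B]%classic)) => _.
    exact: segment_compact.
  apply: subclosed_compact clS cbox _.
  by move=> y Sy i; rewrite /= in_itv /= -ler_norml SB.
have [p Sp pmin] := compact_EVT_min S0 cS (continuous_subspaceT cf).
by exists p => [|y Sy]; [exact: set_mem | apply: pmin; exact: mem_set].
Qed.

(** First-order condition at a minimum: divide by [t] and let [t] tend to 0. *)
Lemma quadratic_ge0_linear (b c : R) :
  (forall t, 0 < t -> t <= 1 -> 0 <= 2 * t * b + t ^+ 2 * c) -> 0 <= b.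
Proof.
move=> h; rewrite leNgt; apply/negP => b0.
(* This [t] satisfies [t <= 1] and [t * c <= |b|], so [2 * b + t * c <= - |b| < 0]. *)
pose M := 1 + `|c| + `|b|; pose t := `|b| / M.
have [c_ge0 b_ge0] := (normr_ge0 c, normr_ge0 b).
have M0 : 0 < M by rewrite /M; lra.
have t0 : 0 < t by rewrite divr_gt0// normr_gt0 lt_eqF.
have t1 : t <= 1 by rewrite ler_pdivrMr// mul1r /M; lra.
have := h _ t0 t1; rewrite (_ : _ + _ = t * (2 * b + t * c)); last by ring.
rewrite pmulr_rge0//.
have : t * c <= `|b|.
  rewrite /t -mulrA ler_piMr// mulrC ler_pdivrMr// mul1r /M.
  by have := ler_norm c; lra.
by rewrite (ltr0_norm b0); lra.
Qed.

Lemma dotvv_addZ u v t : dotv (u + t *: v) (u + t *: v) =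
  dotv u u + (2 * t * dotv u v + t ^+ 2 * dotv v v).
Proof.
by rewrite !dotvDl !dotvDr !dotvZl !dotvZr (dotvC v u); ring.
Qed.

Lemma nearest_point sigma x : sigma !=set0 -> closed sigma ->
  exists2 p, sigma p &
    forall y, sigma y -> dotv (p - x) (p - x) <= dotv (y - x) (y - x).
Proof.
move=> [z sz] cls; pose f y := dotv (y - x) (y - x).
have cf : continuous f.
  by apply: dotv_continuous => y; apply: continuousB => //; exact: cst_continuous.
(* As [sigma] may be unbounded, the search is restricted to points no farther from [x] than [z],
   which form a compact set. *)
have clS : closed (sigma `&` [set y | f y <= f z]).
  apply: closedI => //.
  exact: (preimage_closed (fun y _ => cf y) (@closed_le R (f z))).
have Sbox y : (sigma `&` [set y | f y <= f z]) y ->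
    forall i, `|y ord0 i| <= 1 + f z + \sum_i `|x ord0 i|.
  move=> [_ /= fy] i; have := le_trans (sqr_coord_le_dotvv (y - x) i) fy.
  rewrite !mxE => hi.
  have xi : `|x ord0 i| <= \sum_j `|x ord0 j|.
    by rewrite (bigD1 i)//= lerDl sumr_ge0.
  have := ler_normD (y ord0 i - x ord0 i) (x ord0 i); rewrite subrK.
  move: hi; rewrite -[(_ - _) ^+ 2]ger0_norm ?sqr_ge0// normrX.
  by set q := `| _ - _ |; nra.
have S0 : (sigma `&` [set y | f y <= f z]) !=set0 by exists z; split => //=.
have [p [sp fp] pmin] := closed_box_min S0 clS Sbox cf.
exists p => // y sy; have [fy|/ltW fy] := leP (f y) (f z); first exact: pmin.
exact: le_trans fy.
Qed.

(** Convexity yields the midpoint of [u] and [v]; scaling it by 2 stays in the cone. *)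
Lemma admissible_coneD sigma u v :
  admissible_cone sigma -> sigma u -> sigma v -> sigma (u + v).
Proof.
case=> cs convs _ _ su sv.
have [h0 h1] : 0 <= (2^-1 : R) /\ (2^-1 : R) <= 1 by split; lra.
have /set_mem := convs u v (Itv01 h0 h1) (mem_set su) (mem_set sv).
move=> /(cs 2 _ (ler0n _ _)); congr sigma.
rewrite /conv /= /unstable.onem; apply/rowP => i; rewrite !mxE; lra.
Qed.

(* The separating functional is p - x, with p the point of sigma nearest to x. *)
Lemma admissible_cone_bidual sigma : admissible_cone sigma ->
  dual_cone (dual_cone sigma) `<=` sigma.
Proof.
move=> adm x xdd; have [cs _ cls os] := adm.
have s0 : sigma 0 by apply: os => i; rewrite mxE.
have [p sp pmin] := nearest_point x (ex_intro _ 0 s0) cls.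
suff /eqP : p - x == 0 by move=> /subr0_eq <-.
have ortho y : (forall t, 0 < t -> t <= 1 -> sigma (p + t *: y)) ->
    0 <= dotv (p - x) y.
  move=> spy; apply: (@quadratic_ge0_linear _ (dotv y y)) => t t0 t1.
  have := pmin _ (spy t t0 t1).
  by rewrite addrAC dotvv_addZ lerDl.
have dualp : dual_cone sigma (p - x).
  move=> y sy; apply: (ortho y) => t t0 _; apply: admissible_coneD => //.
  exact: cs (ltW t0) sy.
(* Shrinking [p] towards 0 stays in the cone, so [p - x] has nonpositive product with [p]. Its
   product with [x] is nonnegative by biduality, so its squared norm is at most 0. *)
have : 0 <= dotv (p - x) (- p).
  apply: ortho => t t0 t1; rewrite scalerN -{1}[p]scale1r -scalerBl.
  by apply: cs => //; rewrite subr_ge0.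
have := xdd _ dualp; rewrite dotvC => h1 h2.
rewrite -dotvv_eq0 eq_le dotvv_ge0 andbT.
by move: h2; rewrite dotvC dotvNl (dotvC p) dotvBr; lra.
Qed.

(* Gordan's theorem: w is the point of least norm in the convex hull of the
   nonzero generators. *)
Lemma strongly_convex_interior_dual m (g : 'I_m -> 'rV[R]_n) :
  strongly_convex [set u | exists2 c : 'I_m -> R,
                       (forall i, 0 <= c i) & u = \sum_i c i *: g i] ->
  exists w, forall i, g i != 0 -> 0 < dotv w (g i).
Proof.
move=> sc.
(* A vanishing combination could be solved for [- g i], so the cone would contain the whole line
   through [g i]. *)
have nonzero (c : 'I_m -> R) i : (forall i, 0 <= c i) -> 0 < c i -> g i != 0 ->
    \sum_j c j *: g j != 0.
  move=> c0 ci gi; apply/eqP => sum0.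
  have gi_line : <[g i]>%VS = 0%VS.
    apply: sc => u /vlineP[k ->].
    have [k0|/ltW k0] := leP 0 k.
      exists (fun j => k * (j == i)%:R) => [j|]; first by rewrite mulr_ge0.
      rewrite (bigD1 i)//= eqxx mulr1 big1 ?addr0// => j /negbTE ->.
      by rewrite mulr0 scale0r.
    exists (fun j => - k / c i * (if j == i then 0 else c j)) => [j|].
      rewrite mulr_ge0 ?divr_ge0 ?oppr_ge0 ?(ltW ci)//; case: ifP => // _.
    under eq_bigr do rewrite -scalerA.
    rewrite -scaler_sumr (bigD1 i)//= eqxx scale0r add0r.
    move: sum0; rewrite (bigD1 i)//= => /eqP; rewrite addrC addr_eq0 => /eqP sumE.
    rewrite (eq_bigr (fun j => c j *: g j)) => [|j /negbTE ->//].
    by rewrite sumE scalerN scalerA divfK ?gt_eqF// scaleNr opprK.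
  by move/eqP: gi; apply; apply/eqP; rewrite -memv0 -gi_line memv_line.
have [/forallP g0|/forallPn[i0 gi0]] := boolP [forall i, g i == 0].
  by exists 0 => i; rewrite g0.
(* The hull is parametrized by the simplex of coefficients vanishing on zero generators, which is
   visibly compact. *)
pose S := [set c : 'rV[R]_m | (forall i, 0 <= c ord0 i) /\
  \sum_i c ord0 i = 1 /\ forall i, g i = 0 -> c ord0 i = 0].
pose comb (c : 'rV[R]_m) := \sum_i c ord0 i *: g i.
have ccoord i : continuous (fun c : 'rV[R]_m => c ord0 i) by exact: coord_continuous.
have ccomb : continuous comb.
  apply: continuous_big => [|i _]; first exact: add_continuous.
  move=> c; apply: (@continuousZ _ _ _ (fun c : 'rV[R]_m => c ord0 i) (fun=> g i));
    [exact: ccoord | exact: cst_continuous].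
have clS : closed S.
  rewrite (_ : S = \bigcap_i [set c | 0 <= c ord0 i] `&`
    ([set c | \sum_i c ord0 i = 1] `&`
     \bigcap_(i in [set i | g i = 0]) [set c | c ord0 i = 0])); last first.
    apply/seteqP; split=> c.
      by case=> c0 [c1 cg]; split=> [i _|]; [exact: c0|split=> // i; exact: cg].
    by case=> c0 [c1 cg]; split=> [i|]; [exact: c0|split=> // i; exact: cg].
  have closed_fun (h : 'rV[R]_m -> R) (A : set R) :
    continuous h -> closed A -> closed (h @^-1` A).
    by move=> ch clA; apply: closed_comp => // y _; exact: ch.
  apply: closedI; last apply: closedI.
  - apply: closed_bigI => i _.
    exact: (closed_fun _ _ (ccoord i) (@closed_ge R 0)).
  - have csum : continuous (fun c : 'rV[R]_m => \sum_i c ord0 i).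
      by apply: continuous_big => [|i _]; [exact: add_continuous|exact: ccoord].
    exact: (closed_fun _ _ csum (@closed_eq R 1)).
  - apply: closed_bigI => i _.
    exact: (closed_fun _ _ (ccoord i) (@closed_eq R 0)).
have Sdelta i : g i != 0 -> S (delta_mx ord0 i).
  move=> gi; split=> [j|]; first by rewrite mxE.
  split=> [|j gj].
    by rewrite (bigD1 i)//= mxE !eqxx big1 ?addr0// => j /negbTE ji; rewrite mxE ji.
  by rewrite mxE eqxx /=; case: eqVneq => // ji; rewrite -ji gj eqxx in gi.
have S_box c : S c -> forall i, `|c ord0 i| <= 1.
  move=> [c0 [c1 _]] i; rewrite ger0_norm// -c1 (bigD1 i)//= lerDl.
  exact: sumr_ge0.
have [p Sp pmin] := closed_box_min (ex_intro _ _ (Sdelta _ gi0)) clS S_box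
  (dotv_continuous ccomb ccomb).
have [p0 [p1 pg]] := Sp.
have comb_p : 0 < dotv (comb p) (comb p).
  have [i pi] : exists i, p ord0 i != 0.
    apply/existsP; apply: contraPT p1 => /existsPn pz.
    by rewrite big1 => [/esym/eqP|i _]; [rewrite oner_eq0|apply/eqP/negPn].
  rewrite dotvv_gt0 (nonzero _ i)// ?lt_def ?pi ?p0//.
  by apply: contra_neq pi => /pg.
exists (comb p) => i gi; apply: lt_le_trans comb_p _.
rewrite -subr_ge0 -dotvBr.
(* Moving from [comb p] towards [g i] stays in the hull and cannot decrease the norm, so the product
   of [comb p] with [g i] is at least its squared norm. *)
apply: (@quadratic_ge0_linear _ (dotv (g i - comb p) (g i - comb p))) => t t0 t1.
rewrite -(lerDl (dotv (comb p) (comb p))) -dotvv_addZ.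
have mixE j : ((1 - t) *: p + t *: delta_mx ord0 i) ord0 j =
    (1 - t) * p ord0 j + t * delta_mx (ord0 : 'I_1) i ord0 j.
  by rewrite mxE [X in X + _]mxE [X in _ + X]mxE.
have -> : comb p + t *: (g i - comb p) = comb ((1 - t) *: p + t *: delta_mx ord0 i).
  have combD : comb (delta_mx ord0 i) = g i.
    rewrite /comb (bigD1 i)//= big1 ?addr0 => [|j /negbTE ji].
      by rewrite mxE !eqxx scale1r.
    by rewrite mxE ji andbF scale0r.
  rewrite -{1}combD /comb scalerBr addrCA.
  rewrite -[X in _ + (X - _)]scale1r -scalerBl addrC !scaler_sumr -big_split /=.
  by apply: eq_bigr => j _; rewrite mixE !scalerA -scalerDl.
apply: pmin; have [d0 [d1 dg]] := Sdelta i gi; split=> [j|].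
  by rewrite mixE addr_ge0 ?mulr_ge0 ?subr_ge0 ?(ltW t0).
split=> [|j gj].
  rewrite (eq_bigr _ (fun j _ => mixE j)) big_split /=.
  by rewrite -!mulr_sumr p1 d1 !mulr1 subrK.
by rewrite mixE pg// dg// !mulr0 addr0.
Qed.

End Separation.

(** * Finiteness of supports below each weight level *)

Section LevelFinite.
Variables (R : realType) (K : fieldType) (n : nat).
Implicit Types (f xi : fseries K n) (w : 'rV[R]_n).

Lemma finite_int_box (N : nat) :
  finite_set [set z : 'rV[int]_n | forall i, `|z ord0 i| <= N%:Z].
Proof.
pose h (m : 'rV['I_(N.*2.+1)]_n) : 'rV[int]_n := map_mx (fun i : 'I__ => i%:Z - N%:Z) m.
apply: (@sub_finite_set _ _ (h @` setT)); last first.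
  by apply: finite_image; exact: finite_finset.
move=> z zN; exists (\row_i inord (absz (z ord0 i + N%:Z))) => //.
apply/rowP => i; rewrite !mxE inordK; have := zN i; rewrite ler_norml => /andP[lo hi].
  rewrite gez0_abs; last lia.
  by rewrite addrK.
rewrite -addnn ltnS; lia.
Qed.

Lemma finite_lattice_box (k : nat) (B : R) : (0 < k)%N ->
  finite_set [set a : 'rV[rat]_n |
    (exists z : 'rV[int]_n, a = k%:R^-1 *: map_mx intr z) /\
    forall i, `|ratr (a ord0 i) : R| <= B].
Proof.
move=> k0; pose h (z : 'rV[int]_n) : 'rV[rat]_n := k%:R^-1 *: map_mx intr z.
pose N := Num.bound `|k%:R * B|.
apply: sub_finite_set (finite_image h (finite_int_box N)).
move=> a [[z ->] zB]; exists z => // i.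
have k0R : 0 < k%:R :> R by rewrite ltr0n.
have := zB i; rewrite !mxE rmorphM fmorphV /= ratr_nat ratr_int normrM.
rewrite ger0_norm ?invr_ge0 ?ler0n// ler_pdivrMl// => zi.
rewrite -(ler_int R) intr_norm -pmulrn.
apply: le_trans zi (le_trans (ler_norm _) (ltW _)).
exact: archi_boundP.
Qed.

(** All summands of the weight are nonnegative, so each coordinate is at most [|c| / w_i]; summing
    these bounds gives one box for all coordinates. *)
Lemma power_series_level_finite f w :
  (forall i, 0 < w ord0 i) -> power_series f -> level_finite w f.
Proof.
move=> w0 psf c; pose B := \sum_i `|c| / w ord0 i.
apply: sub_finite_set (@finite_lattice_box 1 B isT) => a [fa ac].
have [m aE] := psf a fa; split.
  exists (map_mx Posz m); apply/rowP => i.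
  by rewrite aE !mxE invr1 mul1r.
have a0 i : 0 <= ratr (a ord0 i) :> R by rewrite aE !mxE ratr_nat.
move=> i; rewrite ger0_norm// /B (bigD1 i)//=.
apply: le_trans (_ : `|c| / w ord0 i <= _); last first.
  by rewrite lerDl sumr_ge0// => j _; rewrite divr_ge0// ltW.
rewrite ler_pdivlMr//; apply: le_trans (le_trans ac (ler_norm _)).
rewrite /weight /dotv (bigD1 i)//= mxE lerDl sumr_ge0// => j _.
by rewrite mxE mulr_ge0// ltW.
Qed.

(* Perturbing a direction of tau(xi) into the interior of the dual of the cone
   makes the support of xi finite below every level. *)
Lemma perturbed_level_finite xi (m : nat) (g : 'I_m -> 'rV[R]_n) v w w0 (e : R) :
  laurent_puiseux xi -> 0 < e -> tau R xi w ->
  (forall i, g i != 0 -> 0 < dotv w0 (g i)) ->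
  SuppR R xi `<=` translate v [set u | exists2 c : 'I_m -> R,
                       (forall i, 0 <= c i) & u = \sum_i c i *: g i] ->
  level_finite (w + e *: w0) xi.
Proof.
move=> [k k0 xik] e0 [_ [b xib]] w0g xiv c.
(* Write an exponent as [v] plus a cone part. Its [w]-weight exceeds [b] and its perturbed weight is
   at most [c], so the cone part has [w0]-weight at most [C]. *)
pose C := `|(c - b) / e - dotv v w0|.
(* Each coefficient of a nonzero generator is at most [C / dotv w0 (g i)]; for a zero generator the
   term is 0. *)
pose B := \sum_j (`|v ord0 j| + \sum_i C / dotv w0 (g i) * `|g i ord0 j|).
apply: sub_finite_set (@finite_lattice_box k B k0) => a [xia ac].
split; first exact: xik.
have xiaR : SuppR R xi (map_mx ratr a) by exists a.
have ab : b < dotv (map_mx ratr a) w.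
  rewrite ltNge; apply/negP => ab.
  by have : set0 (map_mx ratr a : 'rV[R]_n) by rewrite -xib.
have [_ [d d0 ->] aE] := xiv _ xiaR.
have aw0 : \sum_i d i * dotv w0 (g i) <= C.
  apply: le_trans (ler_norm _).
  move: ac; rewrite /weight dotvDr dotvZr -aE [in e * _]dotvDl aE => ac.
  have -> : \sum_i d i * dotv w0 (g i) = dotv (\sum_i d i *: g i) w0.
    by rewrite dotv_suml; apply: eq_bigr => i _; rewrite dotvZl dotvC.
  rewrite lerBrDl ler_pdivlMr// mulrC.
  by move: ac ab; lra.
have dg0 i : 0 <= d i * dotv w0 (g i).
  have [->|/w0g gi] := eqVneq (g i) 0; first by rewrite dotvC dot0v mulr0.
  by rewrite mulr_ge0// ltW.
have C0 : 0 <= C by exact: normr_ge0.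
have Cg0 i j : 0 <= C / dotv w0 (g i) * `|g i ord0 j|.
  have [->|/w0g gi] := eqVneq (g i) 0; first by rewrite mxE normr0 mulr0.
  by rewrite mulr_ge0// divr_ge0// (ltW gi).
move=> j; have -> : ratr (a ord0 j) = (map_mx ratr a : 'rV[R]_n) ord0 j by rewrite mxE.
rewrite -aE !mxE /B (bigD1 j)//=.
apply: le_trans (_ : _ <= `|v ord0 j| + \sum_i C / dotv w0 (g i) * `|g i ord0 j|) _.
  apply: le_trans (ler_normD _ _) _; rewrite lerD2l summxE.
  apply: le_trans (ler_norm_sum _ _ _) _; apply: ler_sum => i _ /=.
  rewrite mxE normrM ger0_norm//.
  have [->|/w0g gi] := eqVneq (g i) 0; first by rewrite mxE normr0 !mulr0.
  rewrite ler_wpM2r// ler_pdivlMr//; apply: le_trans aw0.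
  by rewrite (bigD1 i)//= lerDl sumr_ge0.
by rewrite lerDl sumr_ge0// => l _; rewrite addr_ge0// sumr_ge0.
Qed.

End LevelFinite.

(** Expanding the [j]-th basis vector in the generators writes [w0 ord0 j] as a sum of nonnegative
    terms. If it vanished, every term of the expansion would be zero, and so would the basis
    vector. *)
Lemma cone_orthant_pos (R : realType) (n m : nat) (g : 'I_m -> 'rV[R]_n) w0 :
  (forall i, g i != 0 -> 0 < dotv w0 (g i)) ->
  @orthant R n `<=` [set u | exists2 c : 'I_m -> R,
                       (forall i, 0 <= c i) & u = \sum_i c i *: g i] ->
  forall j, 0 < w0 ord0 j.
Proof.
move=> w0g og j.
have [|c c0 jE] := og (delta_mx ord0 j); first by move=> i; rewrite mxE.
have -> : w0 ord0 j = \sum_i c i * dotv w0 (g i).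
  rewrite (eq_bigr (fun i => dotv (c i *: g i) w0)) => [|i _]; last first.
    by rewrite dotvZl dotvC.
  rewrite -dotv_suml -jE /dotv (bigD1 j)//= mxE !eqxx mul1r big1 ?addr0// => i.
  by move=> /negbTE ij; rewrite mxE ij andbF mul0r.
have term0 i : 0 <= c i * dotv w0 (g i).
  have [->|/w0g gi] := eqVneq (g i) 0; first by rewrite dotvC dot0v mulr0.
  by rewrite mulr_ge0// ltW.
rewrite lt_def sumr_ge0// andbT; apply/eqP => sum0.
have : delta_mx ord0 j = 0 :> 'rV[R]_n.
  rewrite jE big1// => i _; have [->|gi] := eqVneq (g i) 0; first exact: scaler0.
  have /eqP : c i * dotv w0 (g i) = 0 by exact: (psumr_eq0P _ sum0).
  by rewrite mulf_eq0 (gt_eqF (w0g _ gi)) orbF => /eqP ->; rewrite scale0r.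
by move=> /rowP/(_ j); rewrite !mxE !eqxx => /eqP; rewrite oner_eq0.
Qed.

(** * Translating the support, and minimality of the dual cone *)

Lemma algebraic_top_coefficient (K : fieldType) (n d : nat)
    (P : 'I_d -> fseries K n) : (exists i a, P i a != 0) ->
  exists (D : 'I_d) a, P D a != 0 /\
    forall i : 'I_d, (D < i)%N -> forall c, P i c = 0.
Proof.
move=> [i0 Pi0]; pose Q i := `[< exists a, P i a != 0 >].
have Qi0 : Q i0 by apply/asboolP.
have [D /asboolP[a PDa] Dmax] := @arg_maxnP _ i0 Q (@nat_of_ord d) Qi0.
exists D, a; split=> // i Di c; apply/eqP; apply: contraT => Pic.
have /Dmax : Q i by apply/asboolP; exists c.
by rewrite /= leqNgt Di.
Qed.

Lemma ler_limit_perturbation (R : realType) (a b : R) :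
  (forall e, 0 < e -> 0 <= a + e * b) -> 0 <= a.
Proof.
move=> h; rewrite leNgt; apply/negP => a0.
have b0 := normr_ge0 b; have bb := ler_norm b.
have d0 : 0 < 1 + `|b| by lra.
(* With this [e] one has [e * b <= - a / 2], so [a + e * b <= a / 2 < 0]. *)
have /h : 0 < - a / (2 * (1 + `|b|)) by rewrite divr_gt0 ?oppr_gt0// mulr_gt0.
rewrite leNgt => /negP; apply.
have : - a / (2 * (1 + `|b|)) * b <= - a / 2.
  rewrite invfM -!mulrA ler_wpM2l ?oppr_ge0 ?(ltW a0)//.
  by rewrite ler_piMr ?invr_ge0// mulrC ler_pdivrMr// mul1r; lra.
by lra.
Qed.

Lemma tau_weight_bound (R : realType) (K : fieldType) (n : nat)
    (xi : fseries K n) :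
  laurent_puiseux xi ->
  (exists (sigma : set 'rV[R]_n) (v : 'rV[R]_n),
     [/\ polyhedral_cone sigma, strongly_convex sigma,
         @orthant R n `<=` sigma & SuppR R xi `<=` translate v sigma]) ->
  algebraic_fseries xi ->
  exists m : 'rV[nat]_n, forall w, tau R xi w -> forall u, xi u != 0 ->
    0 <= weight w (u + map_mx (fun i => i%:R) m).
Proof.
move=> xip [_ [v [[m [g ->]] sc og xiv]]] [d [P [psP Pneq0 root]]].
have [D [b [PDb Ptop]]] := algebraic_top_coefficient Pneq0.
(* The exponent [b] is fixed before [w], so one translation serves every direction of [tau R xi].
   The leading exponent [p] found below depends on [w] and [e], hence the comparison of [p] with
   [b]. *)
have [mb bE] := psP D b PDb; exists mb => w tw u xiu; rewrite -bE.
have [w0 w0g] := strongly_convex_interior_dual sc.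
have w0_gt0 := cone_orthant_pos w0g og.
apply: (@ler_limit_perturbation _ _ (weight w0 (u + b))) => e e0.
have we_gt0 i : 0 < (w + e *: w0) ord0 i.
  by rewrite !mxE ltr_wpDl ?mulr_gt0//; case: tw => ->.
have [a xia] := leading_exists (perturbed_level_finite xip e0 tw w0g xiv) xiu.
have [p PDp] := leading_exists (power_series_level_finite we_gt0 (psP D)) PDb.
have we_orth : orthant (w + e *: w0) by move=> i; exact: ltW.
have := root_leading_weight we_orth psP Ptop PDp xia root.
have := leading_weight xia xiu; have := leading_weight PDp PDb.
rewrite -dotvZr -dotvDr -/(weight _ _) raddfD /=; lra.
Qed.

Theorem corollary1p4 (R : realType) (K : fieldType) (n : nat)
    (xi : fseries K n)
    (charK : [pchar K] =i pred0)
    (xi_puiseux : laurent_puiseux xi)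
    (xi_cone : exists (sigma : set 'rV[R]_n) (v : 'rV[R]_n),
       [/\ polyhedral_cone sigma, strongly_convex sigma,
           @orthant R n `<=` sigma & SuppR R xi `<=` translate v sigma])
    (xi_algebraic : algebraic_fseries xi) :
  (exists gamma : 'rV[int]_n,
     SuppR R xi `<=` translate (map_mx intr gamma) (dual_cone (tau R xi))) /\
  (forall sigma : set 'rV[R]_n, admissible_cone sigma ->
     (exists gamma' : 'rV[int]_n,
        SuppR R xi `<=` translate (map_mx intr gamma') sigma) ->
     dual_cone (tau R xi) `<=` sigma).
Proof.
split.
  have [m bound] := tau_weight_bound xi_puiseux xi_cone xi_algebraic.
  exists (- map_mx Posz m) => _ [u xiu <-].
  exists (map_mx ratr (u + map_mx (fun i => i%:R) m)).
    by move=> w tw; exact: bound.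
  by apply/rowP => i; rewrite !mxE rmorphD /= ratr_nat rmorphN /= addrCA addNr addr0.
move=> sigma adm [gamma xig] x xtau; apply: (admissible_cone_bidual adm) => w sw.
have [cs _ _ os] := adm; apply: xtau; split.
  (* The basis vectors lie in [sigma], so the coordinates of [w] are nonnegative. *)
  move=> i; have := sw (delta_mx ord0 i).
  rewrite dotvC /dotv (bigD1 i)//= mxE !eqxx mul1r big1 ?addr0 => [|j /negbTE ji].
    by apply; apply: os => j; rewrite mxE.
  by rewrite mxE ji andbF mul0r.
(* On the support the product with [w] is at least that of [gamma]. Subtracting 1 makes the bound
   strict, since the half-space in [tau] is closed. *)
exists (dotv (map_mx intr gamma) w - 1); rewrite -subset0 => u [/xig[y sy <-]] /=.
by rewrite dotvDl; have := sw y sy; rewrite dotvC; lra.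
Qed.
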